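(* Let $q\equiv 1\pmod 4$ be a prime power and $S=S(\mathbb{F}_q)$. The sets $S_{01}^{00}$, $S_{01}^{10}$, $S_{01}^{11}$, $S_{10}^{00}$, $S_{10}^{01}$ and $S_{10}^{11}$ are empty, and $S_{11}^{11}=S_{00}^{00}$. Moreover, let $(x,y)\in S$ be such that [$y+1-x\ne0$ or $x^2-x-1\ne0$] and [$x+1-y\ne0$ or $y^2-y-1\ne0$], and put $\varepsilon=\chi(x-y)$. Then: \begin{itemize} \item $(x,y)\in S_{00}^{00}$ iff $\chi(1-x)=\chi(1-y)=\varepsilon$; \item $(x,y)\in S_{11}^{00}$ iff $\chi(f_1(x,y))=\chi(f_2(x,y))=-\varepsilon$; \item $(x,y)\in S_{00}^{11}$ iff $\chi(f_3(x,y))=\chi(f_4(x,y))=-\varepsilon$; \item $(x,y)\in S_{11}^{01}$ iff $\chi(1-x)=-\varepsilon$, $\chi(y+1-x)=1$ and $\chi(f_1(x,y))=\varepsilon$; \item $(x,y)\in S_{11}^{10}$ iff $\chi(1-y)=-\varepsilon$, $\chi(x+1-y)=1$ and $\chi(f_2(x,y))=\varepsilon$; \item $(x,y)\in S_{00}^{10}$ iff $\chi(1-x)=-\varepsilon$, $\chi(x+xy-y)=1$ and $\chi(f_3(x,y))=\varepsilon$; \item $(x,y)\in S_{00}^{01}$ iff $\chi(1-y)=-\varepsilon$, $\chi(y+xy-x)=1$ and $\chi(f_4(x,y))=\varepsilon$; \item $(x,y)\in S_{01}^{01}$ iff $\chi(y+xy-x)=-\eta$, $\chi(g_1(x,y))=-\eta\varepsilon$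 and $\chi(g_4(x,y))=\eta\varepsilon$, where $\eta=\chi(y+1-x)$; \item $(x,y)\in S_{10}^{10}$ iff $\chi(x+xy-y)=-\eta$, $\chi(g_2(x,y))=-\eta\varepsilon$ and $\chi(g_3(x,y))=\eta\varepsilon$, where $\eta=\chi(x+1-y)$. \end{itemize}
   Context: Let $q$ be an odd prime power, $\mathbb{F}=\mathbb{F}_q$, and $\chi:\mathbb{F}\to\{-1,0,1\}$ the quadratic character with $\chi(0)=0$. A square is an element $z^2$, $z\in\mathbb{F}$; a nonsquare is an element that is not a square. $\Sigma$ is the set of $(a,b)\in\mathbb{F}^2$ with $a\ne b$, $a,b\notin\{0,1\}$ and $ab$, $(1-a)(1-b)$ squares. $S=S(\mathbb{F}_q)$ is the set of $(x,y)\in\mathbb{F}^2$ with $x,y$ squares, $x\ne y$, $\{x,y\}\cap\{0,1\}=\emptyset$. $\Psi:\Sigma\to S$ is $\Psi(a,b)=(a/b,(1-a)/(1-b))$. For $(a,b)\in\Sigma$ let $\psi=\psi_{a,b}:\mathbb{F}\to\mathbb{F}$, $\psi(u)=au$ if $u$ is a square and $\psi(u)=bu$ if $u$ is a nonsquare. Let $E(a,b)$ be the set of $(u,v)\in\mathbb{F}^2\setminus\{(0,0)\}$ with $\psi(\psi(u)-v)=\psi(-v)+\psi(u-v-\psi(-v))$. For $i,j,r,s\in\{0,1\}$, $E_{ij}^{rs}(a,b)$ is the set of $(u,v)\in E(a,b)$ such that: $i=0$ iff $u$ is a square; $j=0$ iff $-v$ is a square; $r=0$ iff $\psi(u)-v$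 is a square; $s=0$ iff $u-v-\psi(-v)$ is a square. $\Sigma_{ij}^{rs}=\{(a,b)\in\Sigma: E_{ij}^{rs}(a,b)\ne\emptyset\}$ and $S_{ij}^{rs}=\Psi(\Sigma_{ij}^{rs})$. Polynomials: $f_1=x^2+y^2-xy-x$, $f_2=y^2+x^2-xy-y$, $f_3=y^2x+xy-x^2-y^2$, $f_4=x^2y+xy-x^2-y^2$, $g_1=x^2+y-2x$, $g_2=y^2+x-2y$, $g_3=x^2+y-2xy$, $g_4=y^2+x-2xy$. *)

(* Defs.v *)
From mathcomp Require Import all_boot all_order all_algebra.

Set Implicit Arguments.
Unset Strict Implicit.
Unset Printing Implicit Defensive.

Import GRing.Theory.
Local Open Scope ring_scope.

Section QuadraticDefs.
Variable F : finFieldType.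
Implicit Types a b u v x y z : F.

(* 0 counts as a square. *)
Definition is_square x : bool := [exists z, x == z ^+ 2].

Definition chi x : int :=
  if x == 0 then 0 else if is_square x then 1 else -1.

Definition Sigma : {set F * F} :=
  [set p | let: (a, b) := p in
     [&& a != b, a \notin [:: 0; 1], b \notin [:: 0; 1],
         is_square (a * b) & is_square ((1 - a) * (1 - b))]].

Definition S : {set F * F} :=
  [set p | let: (x, y) := p in
     [&& is_square x, is_square y, x != y,
         x \notin [:: 0; 1] & y \notin [:: 0; 1]]].

Definition Psi (p : F * F) : F * F :=
  let: (a, b) := p in (a / b, (1 - a) / (1 - b)).

Definition psi a b u : F := if is_square u then a * u else b * u.

Definition E a b : {set F * F} :=
  [set w | let: (u, v) := w in
     ((u, v) != (0, 0)) &&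
     (psi a b (psi a b u - v) ==
        psi a b (- v) + psi a b (u - v - psi a b (- v)))].

(* [Eijrs a b i j r s] is E_{ij}^{rs}(a,b), with subscripts first; the index
   type 'I_2 is {0,1}.  Likewise for [Sigmaijrs] and [Sijrs] below. *)
Definition Eijrs a b (i j r s : 'I_2) : {set F * F} :=
  [set w in E a b | let: (u, v) := w in
     [&& (i == 0) == is_square u,
         (j == 0) == is_square (- v),
         (r == 0) == is_square (psi a b u - v) &
         (s == 0) == is_square (u - v - psi a b (- v))]].

Definition Sigmaijrs (i j r s : 'I_2) : {set F * F} :=
  [set p in Sigma | Eijrs p.1 p.2 i j r s != set0].

Definition Sijrs (i j r s : 'I_2) : {set F * F} :=
  Psi @: Sigmaijrs i j r s.

Definition f1 x y : F := x ^+ 2 + y ^+ 2 - x * y - x.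
Definition f2 x y : F := y ^+ 2 + x ^+ 2 - x * y - y.
Definition f3 x y : F := y ^+ 2 * x + x * y - x ^+ 2 - y ^+ 2.
Definition f4 x y : F := x ^+ 2 * y + x * y - x ^+ 2 - y ^+ 2.
Definition g1 x y : F := x ^+ 2 + y - 2%:R * x.
Definition g2 x y : F := y ^+ 2 + x - 2%:R * y.
Definition g3 x y : F := x ^+ 2 + y - 2%:R * x * y.
Definition g4 x y : F := y ^+ 2 + x - 2%:R * x * y.

End QuadraticDefs.

Arguments Sigma F : clear implicits.
Arguments S F : clear implicits.
Arguments Sigmaijrs F (i j r s)%_R : clear implicits.
Arguments Sijrs F (i j r s)%_R : clear implicits.

(* Main.v *)
(** The map [Psi] is a bijection from [Sigma] onto [S], with inverse
    a = x (1 - y) / (x - y), b = (1 - y) / (x - y).  Once the classes i, j, r, s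
    are prescribed, the equation defining E(a,b) is linear in (u,v); its
    solutions form a line spanned by a vector (c,d) polynomial in (x,y), except
    when both coefficients vanish, which the two extra hypotheses exclude.  On
    the point l (c,d) of that line each class condition is a condition on chi(l)
    times the quadratic character of an explicit polynomial, so the theorem
    becomes a finite sign check.  The value 0 of a character, where 0 counts as a
    square, is ruled out by linear relations between these polynomials. *)
Require Import Defs.
From mathcomp Require Import all_boot all_order all_algebra.
From mathcomp Require Import all_solvable all_field ring.

Set Implicit Arguments.
Unset Strict Implicit.
Unset Printing Implicit Defensive.

Import GRing.Theory.
Local Open Scope ring_scope.

(** * The quadratic character, computed from a generator of the multiplicative group *)

Section QuadraticCharacter.
Variable F : finFieldType.
Implicit Types x y z : F.

Lemma is_squareP x : reflect (exists z, x = z ^+ 2) (is_square x).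
Proof. exact: exists_eqP. Qed.

Lemma expf_card_pred x : x != 0 -> x ^+ #|F|.-1 = 1.
Proof.
move=> x0; apply: (mulfI x0); rewrite -exprS prednK ?expf_card ?mulr1 //.
exact: ltnW (finNzRing_gt1 F).
Qed.

(** The nonzero elements are [#|F|.-1] distinct roots of unity of that order, and such a full set of
    roots in a field contains a primitive one. *)
Lemma finField_prim_root : exists g : F, #|F|.-1.-primitive_root g.
Proof.
have cardF : #|[pred x : F | x != 0]| = #|F|.-1.
  by rewrite -(cardC1 (0 : F)).
have q_gt0 : (0 < #|F|.-1)%N.
  by rewrite -cardF; apply/card_gt0P; exists 1; rewrite inE oner_neq0.
suff /hasP[g _ g_prim] : has #|F|.-1.-primitive_root
    (enum [pred x : F | x != 0]) by exists g.
apply: has_prim_root => //.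
- apply/allP => x; rewrite mem_enum inE => x0; apply/unity_rootP.
  exact: expf_card_pred.
- exact: enum_uniq.
- by rewrite -cardE cardF.
Qed.

Lemma is_square_mul_sqr x z : z != 0 -> is_square (x * z ^+ 2) = is_square x.
Proof.
move=> z0; apply/is_squareP/is_squareP => -[t e].
  by exists (t / z); rewrite expr_div_n -e mulfK // expf_neq0.
by exists (t * z); rewrite e exprMn.
Qed.

Lemma is_square0 : is_square (0 : F).
Proof. by apply/is_squareP; exists 0; rewrite expr0n. Qed.

Lemma chi0 : chi (0 : F) = 0.
Proof. by rewrite /chi eqxx. Qed.

Lemma chi_eq0 x : chi x = 0 -> x = 0.
Proof. by rewrite /chi; case: eqP => // _; case: is_square. Qed.

Lemma chi_range x : [\/ chi x = 0, chi x = 1 | chi x = -1].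
Proof.
rewrite /chi; case: eqP => _; first by constructor 1.
by case: is_square; [constructor 2 | constructor 3].
Qed.

(** Since 0 counts as a square, only the value -1 is excluded. All class conditions are later tested
    in this form. *)
Lemma is_square_chi x : is_square x = (chi x != -1).
Proof.
rewrite /chi; have [->|_] := eqVneq x 0; first by rewrite is_square0.
by case: is_square.
Qed.

Lemma chi_square x : x != 0 -> is_square x -> chi x = 1.
Proof. by move=> /negPf x0 sqx; rewrite /chi x0 sqx. Qed.

Lemma chi1 : chi (1 : F) = 1.
Proof.
rewrite chi_square ?oner_neq0 //.
by apply/is_squareP; exists 1; rewrite expr1n.
Qed.

(** The exponent of [g] is determined modulo the even number [#|F|.-1], so its parity is well
    defined, and squaring doubles it. *)
Lemma is_square_prim_root_exp (g : F) n : #|F|.-1.-primitive_root g ->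
  ~~ odd #|F|.-1 -> is_square (g ^+ n) = ~~ odd n.
Proof.
move=> g_prim evq; apply/is_squareP/idP => [[z gz]|evn]; last first.
  by exists (g ^+ n./2); rewrite -exprM muln2 even_halfK.
have g0 : g != 0.
  apply: contra_eq_neq (prim_expr_order g_prim) => ->.
  by rewrite expr0n eqn0Ngt (prim_order_gt0 g_prim) eq_sym oner_eq0.
have z0 : z != 0.
  by apply: contra_neq (expf_neq0 n g0) => z0; rewrite gz z0 expr0n.
have [m zm] := prim_rootP g_prim (expf_card_pred z0).
move/eqP: gz; rewrite zm -exprM (eq_prim_root_expr g_prim) => /eqP gz.
(* Both [n] and [m * 2] have the parity of their common remainder, because the modulus is even. *)
have /(congr1 odd) := divn_eq n #|F|.-1.
have := divn_eq (m * 2) #|F|.-1; rewrite -gz => /(congr1 odd).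
by rewrite !oddD !oddM (negPf evq) !andbF /= => <- ->; by [].
Qed.

Hypothesis hq : (#|F| = 1 %[mod 4])%N.

Lemma card_pred_dvd : (4 %| #|F|.-1)%N.
Proof.
rewrite -subn1 -eqn_mod_dvd ?hq //.
exact: ltnW (finNzRing_gt1 F).
Qed.

Lemma even_card_pred : ~~ odd #|F|.-1.
Proof. by rewrite -dvdn2; apply: dvdn_trans card_pred_dvd. Qed.

(** On nonzero elements [chi] is the parity of the discrete logarithm to base [g], and logarithms
    add. *)
Lemma chiM x y : chi (x * y) = chi x * chi y.
Proof.
have [->|x0] := eqVneq x 0; first by rewrite mul0r chi0 mul0r.
have [->|y0] := eqVneq y 0; first by rewrite mulr0 chi0 mulr0.
have [g g_prim] := finField_prim_root.
have pow z : z != 0 -> exists n, z = g ^+ n.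
  by move=> z0; have [m ->] := prim_rootP g_prim (expf_card_pred z0); exists m.
have [[m xm] [n yn]] := (pow x x0, pow y y0).
have /negPf xy0 : x * y != 0 by rewrite mulf_neq0.
rewrite /chi xy0 (negPf x0) (negPf y0) xm yn -exprD.
rewrite !is_square_prim_root_exp ?even_card_pred // oddD.
by case: (odd m); case: (odd n).
Qed.

Lemma nonsquare_exists : exists z, chi z = -1.
Proof.
have [g g_prim] := finField_prim_root.
have := is_square_prim_root_exp 1 g_prim even_card_pred.
by rewrite expr1 is_square_chi => /negbT; rewrite negbK => /eqP; exists g.
Qed.

(** With [#|F|.-1] equal to [k * 4], the square of [g ^+ k] is a square root of 1 other than 1,
    hence it is -1. *)
Lemma chiN1 : chi (-1 : F) = 1.
Proof.
have [g g_prim] := finField_prim_root.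
have q_gt0 := prim_order_gt0 g_prim.
rewrite chi_square ?oppr_eq0 ?oner_neq0 //.
apply/is_squareP; have /dvdnP[k qk] := card_pred_dvd; exists (g ^+ k).
have : (g ^+ k ^+ 2) ^+ 2 == 1 by rewrite -!exprM -qk prim_expr_order.
rewrite sqrf_eq1 => /orP[|/eqP-> //].
(* The root 1 is impossible: the order [k * 4] would divide [k * 2], with [k] positive. *)
rewrite -exprM -(prim_order_dvd g_prim) => /dvdn_leq.
rewrite qk muln_gt0 /= andbT => le.
have k0 : (0 < k)%N by move: q_gt0; rewrite qk muln_gt0 andbT.
by move/(_ k0): le; rewrite leq_pmul2l.
Qed.

Lemma chiN x : chi (- x) = chi x.
Proof. by rewrite -mulN1r chiM chiN1 mul1r. Qed.

Lemma chi_mulss x : x != 0 -> chi x * chi x = 1.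
Proof.
move=> x0; have [/chi_eq0 /eqP|->|->//] := chi_range x; last by [].
by rewrite (negPf x0).
Qed.

Lemma chi_div x y : y != 0 -> chi (x / y) = chi x * chi y.
Proof.
move=> y0; transitivity (chi (x / y) * chi y * chi y).
  by rewrite -mulrA chi_mulss ?mulr1.
by rewrite -chiM divfK.
Qed.

End QuadraticCharacter.

(** * Inverting [Psi] and reducing membership to a sign pattern *)

Section Parametrization.
Variable F : finFieldType.
Implicit Types (a b u v x y z k c d e f : F) (i j r s : 'I_2).

Definition fstPsiInv x y : F := x * (1 - y) / (x - y).
Definition sndPsiInv x y : F := (1 - y) / (x - y).

Lemma S_neq x y : (x, y) \in S F ->
  [/\ x != 0, y != 0, 1 - x != 0, 1 - y != 0 & x - y != 0].
Proof.
rewrite !inE !negb_or => /and5P[_ _ xy /andP[x0 x1] /andP[y0 y1]].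
by rewrite !subr_eq0 ![1 == _]eq_sym; split.
Qed.

Lemma Sigma_neq a b : (a, b) \in Sigma F ->
  [/\ a != 0, b != 0, 1 - a != 0, 1 - b != 0 & a - b != 0].
Proof.
rewrite !inE !negb_or => /and5P[ab /andP[a0 a1] /andP[b0 b1] _ _].
by rewrite !subr_eq0 ![1 == _]eq_sym; split.
Qed.

Lemma Psi_Sigma p : p \in Sigma F -> Psi p \in S F.
Proof.
case: p => a b abS; have [a0 b0 a1 b1 ab] := Sigma_neq abS.
move: abS; rewrite !inE !negb_or => /and5P[_ _ _ sq1 sq2].
apply/and5P; split.
- by rewrite -(is_square_mul_sqr _ b0) -mulrA [_^-1 * _]mulrC expr2 mulfK.
- by rewrite -(is_square_mul_sqr _ b1) -mulrA [_^-1 * _]mulrC expr2 mulfK.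
- rewrite -subr_eq0.
  have -> : a / b - (1 - a) / (1 - b) = (a - b) / (b * (1 - b)).
    by field; rewrite b0 b1.
  by rewrite mulf_neq0 ?invr_eq0 ?mulf_neq0.
- rewrite !inE negb_or mulf_neq0 ?invr_eq0 //= -subr_eq0.
  have -> : a / b - 1 = (a - b) / b by field.
  by rewrite mulf_neq0 ?invr_eq0.
- rewrite !inE negb_or mulf_neq0 ?invr_eq0 //= -subr_eq0.
  have -> : (1 - a) / (1 - b) - 1 = - ((a - b) / (1 - b)) by field.
  by rewrite oppr_eq0 mulf_neq0 ?invr_eq0.
Qed.

Lemma PsiK a b x y : (a, b) \in Sigma F -> (x, y) = Psi (a, b) ->
  a = fstPsiInv x y /\ b = sndPsiInv x y.
Proof.
move=> /Sigma_neq[a0 b0 a1 b1 ab] [-> ->]; rewrite /fstPsiInv /sndPsiInv.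
have -> : a / b - (1 - a) / (1 - b) = (a - b) / (b * (1 - b)).
  by field; rewrite b0 b1.
by split; field; rewrite ab b0 b1.
Qed.

(** Writing a, b for the two inverse coordinates, a = x b and 1 - a = y (1 - b). So ab and (1 - a)(1
    - b) are x and y times nonzero squares. *)
Lemma PsiInv_Sigma x y : (x, y) \in S F ->
  (fstPsiInv x y, sndPsiInv x y) \in Sigma F.
Proof.
move=> xyS; have [x0 y0 x1 y1 xy] := S_neq xyS.
move: xyS; rewrite inE => /and5P[sqx sqy _ _ _].
have b0 : sndPsiInv x y != 0 by rewrite mulf_neq0 ?invr_eq0.
have b1E : 1 - sndPsiInv x y = - ((1 - x) / (x - y)).
  by rewrite /sndPsiInv; field.
have b1 : 1 - sndPsiInv x y != 0.
  by rewrite b1E oppr_eq0 mulf_neq0 ?invr_eq0.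
have aE : fstPsiInv x y = x * sndPsiInv x y by rewrite /fstPsiInv mulrA.
have a1E : 1 - fstPsiInv x y = y * (1 - sndPsiInv x y).
  by rewrite /fstPsiInv /sndPsiInv; field.
rewrite inE; apply/and5P; split.
- rewrite -subr_eq0; have -> : fstPsiInv x y - sndPsiInv x y =
    - ((1 - x) * sndPsiInv x y) by rewrite aE; ring.
  by rewrite oppr_eq0 mulf_neq0.
- rewrite !inE negb_or [_ == 1]eq_sym -[1 == _]subr_eq0 a1E aE.
  by rewrite (mulf_neq0 x0 b0) (mulf_neq0 y0 b1).
- by rewrite !inE negb_or [_ == 1]eq_sym -[1 == _]subr_eq0 b0.
- by rewrite aE -mulrA -expr2 is_square_mul_sqr.
- by rewrite a1E -mulrA -expr2 is_square_mul_sqr.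
Qed.

Lemma PsiInvK x y : (x, y) \in S F ->
  Psi (fstPsiInv x y, sndPsiInv x y) = (x, y).
Proof.
move=> /[dup] /PsiInv_Sigma /Sigma_neq[_ b0 _ b1 _] /S_neq[x0 y0 x1 y1 xy] /=.
have -> : 1 - fstPsiInv x y = y * (1 - sndPsiInv x y).
  by rewrite /fstPsiInv /sndPsiInv; field.
have -> : fstPsiInv x y = x * sndPsiInv x y by rewrite /fstPsiInv mulrA.
by congr pair; rewrite mulfK.
Qed.

Lemma Sijrs_sub i j r s p : p \in Sijrs F i j r s -> p \in S F.
Proof. by case/imsetP => w; rewrite inE => /andP[/Psi_Sigma wS _] ->. Qed.

(** Injectivity of [Psi] on [Sigma] leaves a single candidate preimage to test. *)
Lemma mem_Sijrs_Eijrs i j r s x y : (x, y) \in S F ->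
  ((x, y) \in Sijrs F i j r s) =
  (Eijrs (fstPsiInv x y) (sndPsiInv x y) i j r s != set0).
Proof.
move=> xyS; apply/imsetP/idP => [[[a b]]|nE0].
  rewrite inE => /andP[abS nE0] abxy.
  by have [<- <-] := PsiK abS abxy.
exists (fstPsiInv x y, sndPsiInv x y); last by rewrite PsiInvK.
by rewrite inE PsiInv_Sigma.
Qed.

(** On a fixed class [psi] is multiplication by the constant [t] of that class. The four classes
    being prescribed, every [psi] in the equation becomes linear, and collecting u and v gives the
    displayed coefficients. *)
Lemma mem_Eijrs a b i j r s u v :
  let t l := if l == 0 :> 'I_2 then a else b in
  ((u, v) \in Eijrs a b i j r s) =
  [&& (u, v) != (0, 0),
      (t r * t i - t s) * u == (t r - t j - t s + t s * t j) * v,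
      (i == 0) == is_square u, (j == 0) == is_square (- v),
      (r == 0) == is_square (t i * u - v) &
      (s == 0) == is_square (u - v + t j * v)].
Proof.
move=> t; rewrite !inE -!andbA; congr andb.
have psiE l w : (l == 0) = is_square w -> psi a b w = t l * w.
  by rewrite /psi /t => ->; case: ifP.
apply/idP/idP => /and5P[h /eqP hi /eqP hj /eqP hr /eqP hs].
  move: h hr hs; rewrite (psiE _ _ hi) (psiE _ _ hj) => h hr hs.
  have fE : u - v + t j * v = u - v - t j * - v by ring.
  rewrite fE -hi -hj -hr -hs !eqxx !andbT.
  move: h; rewrite (psiE _ _ hr) (psiE _ _ hs) => /eqP h.
  rewrite -subr_eq0; apply/eqP.
  rewrite -[RHS](subrr (t r * (t i * u - v))) {2}h; ring.
have fE : u - v + t j * v = u - v - t j * - v by ring.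
move: hs; rewrite fE => hs.
rewrite (psiE _ _ hi) (psiE _ _ hj) -hi -hj -hr -hs !eqxx !andbT.
rewrite (psiE _ _ hr) (psiE _ _ hs) -subr_eq0.
apply/eqP; move/eqP: h => h.
transitivity ((t r * t i - t s) * u - (t r - t j - t s + t s * t j) * v).
  by ring.
by rewrite h subrr.
Qed.

Lemma solution_line k c d u v : k != 0 -> (c, d) != (0, 0) ->
  (u, v) != (0, 0) -> k * d * u = k * c * v ->
  exists2 l, l != 0 & u = l * c /\ v = l * d.
Proof.
move=> k0 cd0 uv0; rewrite -!mulrA => /(mulfI k0) duv.
have [c0|c0] := eqVneq c 0.
  have d0 : d != 0 by apply: contraNneq cd0 => d0; rewrite c0 d0.
  have u0 : u = 0 by apply: (mulfI d0); rewrite duv c0 mul0r mulr0.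
  exists (v / d); last by rewrite divfK // u0 c0 mulr0.
  rewrite mulf_neq0 ?invr_eq0 //.
  by apply: contraNneq uv0 => v0; rewrite u0 v0.
have vE : v = u / c * d by apply: (mulfI c0); rewrite -duv; field.
exists (u / c); last by rewrite divfK.
rewrite mulf_neq0 ?invr_eq0 //.
by apply: contraNneq uv0 => u0; rewrite vE u0 mul0r mul0r.
Qed.

Hypothesis hq : (#|F| = 1 %[mod 4])%N.

(* [sg] is the character of the multiplier l of the solution line; [eps], which
   accounts for the denominator x - y, only affects the last two classes. *)
Definition class_pattern i j r s (eps cc cd ce cf : int) : bool :=
  has (fun sg : int =>
    [&& (i == 0) == (sg * cc != -1), (j == 0) == (sg * cd != -1),
        (r == 0) == (sg * (ce * eps) != -1) &
        (s == 0) == (sg * (cf * eps) != -1)])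
   [:: 1; -1].

(** The common factor [k] cancels, leaving the line spanned by [(c, d)]. Scaling by l multiplies the
    argument of each class test by l, so only [chi l] matters. *)
Lemma mem_Sijrs i j r s x y k c d e f : (x, y) \in S F ->
  let t l := if l == 0 :> 'I_2 then fstPsiInv x y else sndPsiInv x y in
  k != 0 -> (c, d) != (0, 0) ->
  t r - t j - t s + t s * t j = k * c -> t r * t i - t s = k * d ->
  t i * c - d = e / (x - y) -> c - d + t j * d = f / (x - y) ->
  ((x, y) \in Sijrs F i j r s) =
    class_pattern i j r s (chi (x - y)) (chi c) (chi d) (chi e) (chi f).
Proof.
move=> xyS t k0 cd0 kc kd eE fE; have [_ _ _ _ xy] := S_neq xyS.
have bits l : l != 0 -> ((l * c, l * d) \in
    Eijrs (fstPsiInv x y) (sndPsiInv x y) i j r s) =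
  [&& (i == 0) == (chi l * chi c != -1), (j == 0) == (chi l * chi d != -1),
      (r == 0) == (chi l * (chi e * chi (x - y)) != -1) &
      (s == 0) == (chi l * (chi f * chi (x - y)) != -1)].
  move=> l0; rewrite mem_Eijrs -/t !is_square_chi kc kd.
  have -> : (l * c, l * d) != (0, 0).
    apply: contraNneq cd0 => -[/eqP]; rewrite mulf_eq0 (negPf l0) /= => /eqP->.
    by move=> /eqP; rewrite mulf_eq0 (negPf l0) /= => /eqP->.
  have -> : k * d * (l * c) == k * c * (l * d) by apply/eqP; ring.
  have -> : t i * (l * c) - l * d = l * (e / (x - y)) by rewrite -eE; ring.
  have -> : l * c - l * d + t j * (l * d) = l * (f / (x - y)).
    by rewrite -fE; ring.
  (* The class of -v is that of v, since -1 is a square. *)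
  by rewrite chiN // !(chiM hq l) !chi_div.
rewrite mem_Sijrs_Eijrs //; apply/set0Pn/idP => [[[u v] uvE]|].
  have [l l0 [uE vE]] : exists2 l, l != 0 & u = l * c /\ v = l * d.
    move: uvE; rewrite mem_Eijrs => /and5P[uv0 /eqP uv _ _ _].
    by apply: (solution_line k0 cd0 uv0); rewrite -kc -kd.
  move: uvE; rewrite uE vE (bits _ l0) /class_pattern /=.
  have [/chi_eq0/eqP|->->|->->] := chi_range l; rewrite ?orbT //.
  by rewrite (negPf l0).
(* Conversely, sign 1 is realized by the multiplier 1 and sign -1 by any nonsquare. *)
rewrite /class_pattern /= orbF => /orP[] h.
  by exists (1 * c, 1 * d); rewrite bits ?oner_neq0 // chi1.
have [z zN] := nonsquare_exists hq; exists (z * c, z * d).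
rewrite bits ?zN //.
by apply/eqP => z0; move: zN; rewrite z0 chi0.
Qed.

End Parametrization.

(** * The sign check, one choice of classes at a time *)

Section Cases.
Variable F : finFieldType.
Hypothesis hq : (#|F| = 1 %[mod 4])%N.
Variables x y : F.
Hypothesis xyS : (x, y) \in S F.

(* For every i, j, r, s, both coefficients of the equation are multiples of [P]. *)
Let P := (1 - x) * (1 - y) / (x - y) ^+ 2.

Let x_neq0 : x != 0. Proof. by have [] := S_neq xyS. Qed.
Let y_neq0 : y != 0. Proof. by have [] := S_neq xyS. Qed.
Let xy_neq0 : x - y != 0. Proof. by have [] := S_neq xyS. Qed.

Let P_neq0 : P != 0.
Proof.
have [_ _ x1 y1 xy] := S_neq xyS.
by rewrite /P !(mulf_neq0, invr_eq0, expf_neq0).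
Qed.

Let chi_x : chi x = 1.
Proof. by apply: chi_square => //; move: xyS; rewrite inE => /and5P[]. Qed.

Let chi_y : chi y = 1.
Proof. by apply: chi_square => //; move: xyS; rewrite inE => /and5P[]. Qed.

Let chi_xy : chi (x - y) != 0.
Proof. by apply: contra_neq xy_neq0 => /chi_eq0. Qed.

Let pair_neq0l (c d : F) : c != 0 -> (c, d) != (0, 0).
Proof. by apply: contra_neq => -[]. Qed.

Let pair_neq0r (c d : F) : d != 0 -> (c, d) != (0, 0).
Proof. by apply: contra_neq => -[]. Qed.

(** The coefficients have common factor [m * P], [(c, d)] spans the solution line, and [e], [f] are
    the numerators over [x - y] of the last two class tests. Factors x, y and -1 are then erased
    from the characters, where they contribute 1. *)
Local Ltac line m c d e f :=
  rewrite (@mem_Sijrs _ hq _ _ _ _ x y (m * P) c d e f xyS);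
  [ rewrite ?(chiM hq, chiN hq, chi1, chi_x, chi_y) ?mul1r ?mulr1
  | by apply: mulf_neq0 P_neq0; rewrite ?mulf_neq0 ?oner_neq0
  | first [ by apply: pair_neq0l; rewrite ?oner_neq0
          | by apply: pair_neq0r | by [] ]
  | rewrite /= /P /fstPsiInv /sndPsiInv ?/f1 ?/f2 ?/f3 ?/f4 ?/g1 ?/g2 ?/g3 ?/g4;
    by field ..].

Let chi_1x : chi (1 - x) != 0.
Proof. by have [_ _ x1 _ _] := S_neq xyS; apply: contra_neq x1 => /chi_eq0. Qed.

Let chi_1y : chi (1 - y) != 0.
Proof. by have [_ _ _ y1 _] := S_neq xyS; apply: contra_neq y1 => /chi_eq0. Qed.

(** Here and in the next five lemmas [c] and [d] lie among 1, x, y, hence are nonzero squares. So u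
    and -v always share their class, which contradicts i being different from j. *)
Lemma notin_S0100 : ((x, y) \in Sijrs F 0 1 0 0) = false.
Proof.
by line y (1 : F) x (x * (1 - y) - x * (x - y))
  (x - y - x * (x - y) + x * (1 - y)).
Qed.

Lemma notin_S0110 : ((x, y) \in Sijrs F 0 1 1 0) = false.
Proof. by line x (1 : F) (1 : F) (y * (1 - x)) (1 - y). Qed.

Lemma notin_S0111 : ((x, y) \in Sijrs F 0 1 1 1) = false.
Proof.
by line (1 : F) (1 : F) y (x * (1 - y) - y * (x - y))
  (x - y - y * (x - y) + y * (1 - y)).
Qed.

Lemma notin_S1000 : ((x, y) \in Sijrs F 1 0 0 0) = false.
Proof.
by line x y (1 : F) (y * (1 - y) - (x - y))
  ((y - 1) * (x - y) + x * (1 - y)).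
Qed.

Lemma notin_S1001 : ((x, y) \in Sijrs F 1 0 0 1) = false.
Proof. by line y (1 : F) (1 : F) (1 - x) (x * (1 - y)). Qed.

Lemma notin_S1011 : ((x, y) \in Sijrs F 1 0 1 1) = false.
Proof.
by line (1 : F) x (1 : F) (x * (1 - y) - (x - y))
  ((x - 1) * (x - y) + x * (1 - y)).
Qed.

Lemma mem_S0000 : ((x, y) \in Sijrs F 0 0 0 0) =
  (chi (1 - x) == chi (x - y)) && (chi (1 - y) == chi (x - y)).
Proof.
line (x * y) (1 : F) (1 : F) (y * (1 - x)) (x * (1 - y)).
move: chi_xy chi_1x chi_1y.
by case: (chi_range (x - y)) => ->; case: (chi_range (1 - x)) => ->;
  case: (chi_range (1 - y)) => ->.
Qed.

(** Compared with the classes 0000, the multiplier sign is -1 instead of 1. This flips all four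
    tests at once, and the criterion is the same. *)
Lemma mem_S1111 : ((x, y) \in Sijrs F 1 1 1 1) =
  (chi (1 - x) == chi (x - y)) && (chi (1 - y) == chi (x - y)).
Proof.
line (1 : F) (1 : F) (1 : F) (1 - x) (1 - y).
move: chi_xy chi_1x chi_1y.
by case: (chi_range (x - y)) => ->; case: (chi_range (1 - x)) => ->;
  case: (chi_range (1 - y)) => ->.
Qed.

Lemma mem_S1100 : ((x, y) \in Sijrs F 1 1 0 0) =
  (chi (f1 x y) == - chi (x - y)) && (chi (f2 x y) == - chi (x - y)).
Proof.
line (1 : F) y x (- f2 x y) (- f1 x y).
have f2E : f2 x y = f1 x y + (x - y) by rewrite /f1 /f2; ring.
(* The tests r = s = 0 would tolerate a vanishing polynomial. But if one of [f1], [f2] vanishes, the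
   other gets character [chi (x - y)] and fails its own test. *)
have f10 : (chi (f1 x y) != 0) || (chi (f2 x y) == chi (x - y)).
  by case: eqP => //= /chi_eq0 f0; rewrite f2E f0 add0r.
have f20 : (chi (f2 x y) != 0) || (chi (f1 x y) == chi (x - y)).
  case: eqP => //= /chi_eq0 f0; rewrite -(chiN hq (x - y)).
  by rewrite -[f1 _ _](addrK (x - y)) -f2E f0 add0r.
move: chi_xy f10 f20.
by case: (chi_range (x - y)) => ->; case: (chi_range (f1 x y)) => ->;
  case: (chi_range (f2 x y)) => ->.
Qed.

Lemma mem_S0011 : ((x, y) \in Sijrs F 0 0 1 1) =
  (chi (f3 x y) == - chi (x - y)) && (chi (f4 x y) == - chi (x - y)).
Proof.
line (1 : F) x y (- f4 x y) (- f3 x y).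
have f4E : f4 x y = f3 x y + x * y * (x - y) by rewrite /f3 /f4; ring.
have f30 : (chi (f3 x y) != 0) || (chi (f4 x y) == chi (x - y)).
  case: eqP => //= /chi_eq0 f0; rewrite f4E f0 add0r !(chiM hq).
  by rewrite chi_x chi_y !mul1r.
have f40 : (chi (f4 x y) != 0) || (chi (f3 x y) == chi (x - y)).
  case: eqP => //= /chi_eq0 f0.
  rewrite -[f3 _ _](addrK (x * y * (x - y))) -f4E f0 add0r (chiN hq) !(chiM hq).
  by rewrite chi_x chi_y !mul1r.
move: chi_xy f30 f40.
by case: (chi_range (x - y)) => ->; case: (chi_range (f3 x y)) => ->;
  case: (chi_range (f4 x y)) => ->.
Qed.

Lemma mem_S1101 : ((x, y) \in Sijrs F 1 1 0 1) =
  [&& chi (1 - x) == - chi (x - y), chi (y + 1 - x) == 1 &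
      chi (f1 x y) == chi (x - y)].
Proof.
line (1 : F) (y + 1 - x) y (1 - x) (- f1 x y).
move: chi_xy chi_1x.
by case: (chi_range (x - y)) => ->; case: (chi_range (1 - x)) => ->;
  case: (chi_range (y + 1 - x)) => ->; case: (chi_range (f1 x y)) => ->.
Qed.

Lemma mem_S1110 : ((x, y) \in Sijrs F 1 1 1 0) =
  [&& chi (1 - y) == - chi (x - y), chi (x + 1 - y) == 1 &
      chi (f2 x y) == chi (x - y)].
Proof.
line (1 : F) x (x + 1 - y) (- f2 x y) (1 - y).
move: chi_xy chi_1y.
by case: (chi_range (x - y)) => ->; case: (chi_range (1 - y)) => ->;
  case: (chi_range (x + 1 - y)) => ->; case: (chi_range (f2 x y)) => ->.
Qed.

(** The square [d] = x forces sign 1. The zeros tolerated by the tests on [c] = x + xy - y and on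
    [f3] are excluded by [f3E]: as [chi (1 - x)] is [- chi (x - y)], the vanishing of either one
    makes the other fail its test. *)
Lemma mem_S0010 : ((x, y) \in Sijrs F 0 0 1 0) =
  [&& chi (1 - x) == - chi (x - y), chi (x + x * y - y) == 1 &
      chi (f3 x y) == chi (x - y)].
Proof.
line (1 : F) (x + x * y - y) x (x * y ^+ 2 * (1 - x)) (- f3 x y).
have f3E : - f3 x y = (x + x * y - y) * (x - y) + x * y * (1 - x).
  by rewrite /f3; ring.
have f30 : (chi (f3 x y) != 0) ||
    (chi (x + x * y - y) * chi (x - y) == chi (1 - x)).
  case: eqP => //= /chi_eq0 f0; rewrite -(chiM hq).
  rewrite -[X in chi X](addrK (x * y * (1 - x))) -f3E f0 oppr0 add0r (chiN hq).
  by rewrite !(chiM hq) chi_x chi_y !mul1r.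
have c0 : (chi (x + x * y - y) != 0) || (chi (f3 x y) == chi (1 - x)).
  case: eqP => //= /chi_eq0 c0; rewrite -(chiN hq) f3E c0 mul0r add0r.
  by rewrite !(chiM hq) chi_x chi_y !mul1r.
move: chi_xy chi_1x f30 c0.
by case: (chi_range (x - y)) => ->; case: (chi_range (1 - x)) => ->;
  case: (chi_range (x + x * y - y)) => ->; case: (chi_range (f3 x y)) => ->.
Qed.

Lemma mem_S0001 : ((x, y) \in Sijrs F 0 0 0 1) =
  [&& chi (1 - y) == - chi (x - y), chi (y + x * y - x) == 1 &
      chi (f4 x y) == chi (x - y)].
Proof.
line (1 : F) y (y + x * y - x) (- f4 x y) (y * x ^+ 2 * (1 - y)).
have f4E : f4 x y = (y + x * y - x) * (x - y) - x * y * (1 - y).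
  by rewrite /f4; ring.
have f40 : (chi (f4 x y) != 0) ||
    (chi (y + x * y - x) * chi (x - y) == chi (1 - y)).
  case: eqP => //= /chi_eq0 f0; rewrite -(chiM hq).
  rewrite -[X in chi X](subrK (x * y * (1 - y))) -f4E f0 add0r.
  by rewrite !(chiM hq) chi_x chi_y !mul1r.
have d0 : (chi (y + x * y - x) != 0) || (chi (f4 x y) == chi (1 - y)).
  case: eqP => //= /chi_eq0 c0; rewrite f4E c0 mul0r add0r (chiN hq).
  by rewrite !(chiM hq) chi_x chi_y !mul1r.
move: chi_xy chi_1y f40 d0.
by case: (chi_range (x - y)) => ->; case: (chi_range (1 - y)) => ->;
  case: (chi_range (y + x * y - x)) => ->; case: (chi_range (f4 x y)) => ->.
Qed.

Lemma mem_S0101 : y + 1 - x <> 0 \/ x ^+ 2 - x - 1 <> 0 ->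
  ((x, y) \in Sijrs F 0 1 0 1) =
  (let eta := chi (y + 1 - x) in
   [&& chi (y + x * y - x) == - eta, chi (g1 x y) == - eta * chi (x - y) &
      chi (g4 x y) == eta * chi (x - y)]).
Proof.
move=> nondeg.
(* On y = x - 1 the second coordinate becomes x^2 - x - 1, so the hypothesis says exactly that the
   line is not degenerate. *)
have cd0 : (y + 1 - x, y + x * y - x) != (0, 0).
  apply/eqP=> -[c0 d0]; case: nondeg => [//|]; apply.
  have yE : y = x - 1 by apply/eqP; rewrite -subr_eq0 -c0; apply/eqP; ring.
  by rewrite -[RHS]d0 yE; ring.
line (1 : F) (y + 1 - x) (y + x * y - x) (g4 x y) (- y * g1 x y).
(* Neither coordinate has a known character, so the multiplier sign is not fixed in advance: the
   test j = 1 makes it [- chi (y + x * y - x)]. The facts [c0] and [g40] exclude the zeros tolerated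
   by i = 0 and r = 0, so that the sign is eta; [cd] excludes eta = 0 in the converse. *)
have c0 : (chi (y + 1 - x) != 0) ||
    (chi (g4 x y) == chi (y + x * y - x) * chi (x - y)).
  case: eqP => //= /chi_eq0 c0; rewrite -(chiM hq) -(chiN hq (g4 _ _)).
  apply/eqP; congr chi.
  (* The identity is (y + xy - x)(x - y) = - g4 + x(1 - y)(y + 1 - x), whose last term vanishes
     here. *)
  rewrite -[LHS]addr0 -[in LHS](mulr0 (x * (1 - y))) -c0 /g4.
  by ring.
have g40 : (chi (g4 x y) != 0) || (chi (y + x * y - x) == chi (y + 1 - x)).
  case: eqP => //= /chi_eq0 g0.
  have -> : y + x * y - x = y * (y + 1 - x) - g4 x y by rewrite /g4; ring.
  by rewrite g0 subr0 (chiM hq) chi_y mul1r.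
have cd : (chi (y + 1 - x) != 0) || (chi (y + x * y - x) != 0).
  apply: contraNT cd0; rewrite negb_or !negbK.
  by move=> /andP[/eqP/chi_eq0-> /eqP/chi_eq0->].
move: chi_xy c0 g40 cd.
by case: (chi_range (x - y)) => ->; case: (chi_range (y + 1 - x)) => ->;
  case: (chi_range (y + x * y - x)) => ->; case: (chi_range (g1 x y)) => ->;
  case: (chi_range (g4 x y)) => ->.
Qed.

(** Mirror image of the previous case under exchange of x and y: now the test i = 1 determines the
    sign, and eta is the character of [d]. *)
Lemma mem_S1010 : x + 1 - y <> 0 \/ y ^+ 2 - y - 1 <> 0 ->
  ((x, y) \in Sijrs F 1 0 1 0) =
  (let eta := chi (x + 1 - y) in
   [&& chi (x + x * y - y) == - eta, chi (g2 x y) == - eta * chi (x - y) &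
      chi (g3 x y) == eta * chi (x - y)]).
Proof.
move=> nondeg.
have cd0 : (x + x * y - y, x + 1 - y) != (0, 0).
  apply/eqP=> -[c0 d0]; case: nondeg => [//|]; apply.
  have xE : x = y - 1 by apply/eqP; rewrite -subr_eq0 -d0; apply/eqP; ring.
  by rewrite -[RHS]c0 xE; ring.
line (1 : F) (x + x * y - y) (x + 1 - y) (- x * g2 x y) (g3 x y).
have d0 : (chi (x + 1 - y) != 0) ||
    (chi (g3 x y) == chi (x + x * y - y) * chi (x - y)).
  case: eqP => //= /chi_eq0 d0; rewrite -(chiM hq).
  apply/eqP; congr chi.
  rewrite -[RHS]addr0 -[in RHS](mulr0 (y * (1 - x))) -d0 /g3.
  by ring.
have g30 : (chi (g3 x y) != 0) || (chi (x + x * y - y) == chi (x + 1 - y)).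
  case: eqP => //= /chi_eq0 g0.
  have -> : x + x * y - y = x * (x + 1 - y) - g3 x y by rewrite /g3; ring.
  by rewrite g0 subr0 (chiM hq) chi_x mul1r.
have cd : (chi (x + x * y - y) != 0) || (chi (x + 1 - y) != 0).
  apply: contraNT cd0; rewrite negb_or !negbK.
  by move=> /andP[/eqP/chi_eq0-> /eqP/chi_eq0->].
move: chi_xy d0 g30 cd.
by case: (chi_range (x - y)) => ->; case: (chi_range (x + 1 - y)) => ->;
  case: (chi_range (x + x * y - y)) => ->; case: (chi_range (g2 x y)) => ->;
  case: (chi_range (g3 x y)) => ->.
Qed.

End Cases.

(** * From the boolean criteria to the stated equivalences *)

Theorem theorem2p10 (F : finFieldType) (q : nat) (hqF : #|F| = q)
    (hq : (q = 1 %[mod 4])%N) :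
  (Sijrs F 0 1 0 0 = set0 /\ Sijrs F 0 1 1 0 = set0 /\
   Sijrs F 0 1 1 1 = set0 /\ Sijrs F 1 0 0 0 = set0 /\
   Sijrs F 1 0 0 1 = set0 /\ Sijrs F 1 0 1 1 = set0) /\
  Sijrs F 1 1 1 1 = Sijrs F 0 0 0 0 /\
  (forall x y : F, (x, y) \in S F ->
    (y + 1 - x <> 0 \/ x ^+ 2 - x - 1 <> 0) ->
    (x + 1 - y <> 0 \/ y ^+ 2 - y - 1 <> 0) ->
    let eps := chi (x - y) in
    ((x, y) \in Sijrs F 0 0 0 0 <->
       chi (1 - x) = eps /\ chi (1 - y) = eps) /\
    ((x, y) \in Sijrs F 1 1 0 0 <->
       chi (f1 x y) = - eps /\ chi (f2 x y) = - eps) /\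
    ((x, y) \in Sijrs F 0 0 1 1 <->
       chi (f3 x y) = - eps /\ chi (f4 x y) = - eps) /\
    ((x, y) \in Sijrs F 1 1 0 1 <->
       chi (1 - x) = - eps /\ chi (y + 1 - x) = 1 /\ chi (f1 x y) = eps) /\
    ((x, y) \in Sijrs F 1 1 1 0 <->
       chi (1 - y) = - eps /\ chi (x + 1 - y) = 1 /\ chi (f2 x y) = eps) /\
    ((x, y) \in Sijrs F 0 0 1 0 <->
       chi (1 - x) = - eps /\ chi (x + x * y - y) = 1 /\ chi (f3 x y) = eps) /\
    ((x, y) \in Sijrs F 0 0 0 1 <->
       chi (1 - y) = - eps /\ chi (y + x * y - x) = 1 /\ chi (f4 x y) = eps) /\
    ((x, y) \in Sijrs F 0 1 0 1 <->
       let eta := chi (y + 1 - x) in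
       chi (y + x * y - x) = - eta /\ chi (g1 x y) = - eta * eps /\
       chi (g4 x y) = eta * eps) /\
    ((x, y) \in Sijrs F 1 0 1 0 <->
       let eta := chi (x + 1 - y) in
       chi (x + x * y - y) = - eta /\ chi (g2 x y) = - eta * eps /\
       chi (g3 x y) = eta * eps)).
Proof.
have hF : (#|F| = 1 %[mod 4])%N by rewrite hqF.
have emptyS i j r s : (forall x y, (x, y) \in S F ->
    ((x, y) \in Sijrs F i j r s) = false) -> Sijrs F i j r s = set0.
  move=> notinS; apply/setP => -[x y]; rewrite in_set0.
  by apply/negP => /[dup] /Sijrs_sub /notinS ->.
(* Each pair packs the two sides of one equation. *)
have iff2 (p q' : int * int) : (p.1 == p.2) && (q'.1 == q'.2) <->
    p.1 = p.2 /\ q'.1 = q'.2.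
  by split=> [/andP[/eqP-> /eqP->]|[-> ->]]; rewrite ?eqxx.
have iff3 (p q' r : int * int) :
    [&& p.1 == p.2, q'.1 == q'.2 & r.1 == r.2] <->
    p.1 = p.2 /\ q'.1 = q'.2 /\ r.1 = r.2.
  by split=> [/and3P[/eqP-> /eqP-> /eqP->]|[-> [-> ->]]]; rewrite ?eqxx.
split.
  split; first by apply: emptyS => x y xyS; exact: notin_S0100.
  split; first by apply: emptyS => x y xyS; exact: notin_S0110.
  split; first by apply: emptyS => x y xyS; exact: notin_S0111.
  split; first by apply: emptyS => x y xyS; exact: notin_S1000.
  split; first by apply: emptyS => x y xyS; exact: notin_S1001.
  by apply: emptyS => x y xyS; exact: notin_S1011.
split.
  (* On [S] the two criteria coincide; outside [S] neither set has a point. *)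
  apply/setP => -[x y]; have [xyS|xynS] := boolP ((x, y) \in S F).
    by rewrite mem_S1111 ?mem_S0000.
  by apply/idP/idP => /Sijrs_sub; rewrite (negPf xynS).
move=> x y xyS nondeg01 nondeg10 eps.
rewrite mem_S0000 // mem_S1100 // mem_S0011 // mem_S1101 // mem_S1110 //.
rewrite mem_S0010 // mem_S0001 // mem_S0101 // mem_S1010 //.
split; first exact: (iff2 (_, _) (_, _)).
split; first exact: (iff2 (_, _) (_, _)).
split; first exact: (iff2 (_, _) (_, _)).
split; first exact: (iff3 (_, _) (_, _) (_, _)).
split; first exact: (iff3 (_, _) (_, _) (_, _)).
split; first exact: (iff3 (_, _) (_, _) (_, _)).
split; first exact: (iff3 (_, _) (_, _) (_, _)).
by split; exact: (iff3 (_, _) (_, _) (_, _)).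
Qed.
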